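(* The randomized query complexity of local search on the Boolean hypercube $\{0,1\}^n$ is $\Omega\left(\frac{2^{n/2}}{n}\right)$ as $n\to\infty$.
   Context: Boolean hypercube: the graph whose vertices are the bit strings of length $n$, with two strings adjacent iff they differ in exactly one bit. Local search: $G=(V,E)$ is a finite connected undirected graph known to the algorithm, and $f:V\to\mathbb{R}$ is an unknown function accessible through an oracle; a query names a vertex $v$ and receives $f(v)$. A vertex $v$ is a local minimum if $f(v)\le f(u)$ for all $\{u,v\}\in E$. The task is to output a local minimum. Randomized query complexity: the minimum over randomized algorithms that, for every input $f$, output a correct solution with probability at least $9/10$, of the worst-case (over inputs) expected number of queries, the expectation being over the algorithm's coin tosses. *)

(* Defs.v *)
From HB Require Import structures.
From mathcomp Require Import all_boot all_order all_algebra.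
From mathcomp Require Import all_classical all_reals all_analysis.

Set Implicit Arguments.
Unset Strict Implicit.
Unset Printing Implicit Defensive.

Import Order.TTheory GRing.Theory Num.Theory.
Import numFieldNormedType.Exports.

Local Open Scope classical_set_scope.
Local Open Scope ring_scope.

Definition hypercube (n : nat) : rel (n.-tuple bool) :=
  fun x y => #|[set i : 'I_n | tnth x i != tnth y i]%SET| == 1%N.

Definition local_min (R : realType) (V : finType) (e : rel V) (f : V -> R)
    (v : V) : Prop :=
  forall u : V, e v u -> f v <= f u.

Inductive action (V : Type) : Type := Query of V | Output of V.

(* The query-answer pairs seen so far, oldest first. *)
Definition history (R V : Type) : Type := seq (V * R).

Definition det_alg (R V : Type) : Type := history R V -> action V.

(* The history after k steps.  Once the algorithm outputs a vertex it has
   halted, and the history no longer changes. *)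
Fixpoint run (R V : Type) (s : det_alg R V) (f : V -> R) (k : nat) :
    history R V :=
  if k is k'.+1 then
    let h := run s f k' in
    if s h is Query v then rcons h (v, f v) else h
  else [::].

Definition outputs (R V : Type) (s : det_alg R V) (f : V -> R) (v : V) : Prop :=
  exists k, s (run s f k) = Output v.

(* +oo when the algorithm never halts on f. *)
Definition num_queries (R : realType) (V : Type) (s : det_alg R V)
    (f : V -> R) : \bar R :=
  (\sum_(0 <= k <oo) if s (run s f k) is Query _ then 1 else 0)%E.

(* The coin tosses are drawn once, at the start, from an arbitrary probability
   space; the resulting deterministic algorithm is then run.  Measurability
   says that each single decision is a random variable. *)
Record rand_alg (R : realType) (V : Type) := RandAlg {
  coins_display : measure_display;
  coins : measurableType coins_display;
  coins_law : probability coins R;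
  decide : coins -> det_alg R V;
  measurable_decide : forall (h : history R V) (a : action V),
    measurable [set w : coins | decide w h = a]
}.

Arguments decide {R V} r _ _.

Definition success_probability (R : realType) (V : finType) (e : rel V)
    (A : rand_alg R V) (f : V -> R) : \bar R :=
  coins_law A
    [set w | exists v, outputs (decide A w) f v /\ local_min e f v].

Definition expected_queries (R : realType) (V : finType) (A : rand_alg R V)
    (f : V -> R) : \bar R :=
  (\int[coins_law A]_w num_queries (decide A w) f)%E.

Definition solves_local_search (R : realType) (V : finType) (e : rel V)
    (A : rand_alg R V) : Prop :=
  forall f : V -> R, ((9 / 10)%:E <= success_probability e A f)%E.

Definition worst_case_queries (R : realType) (V : finType)
    (A : rand_alg R V) : \bar R :=
  ereal_sup [set expected_queries A f | f in [set: V -> R]].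

Definition randomized_query_complexity (R : realType) (V : finType)
    (e : rel V) : \bar R :=
  ereal_inf [set q : \bar R | exists A : rand_alg R V,
    solves_local_search e A /\ worst_case_queries A = q].

(* Main.v *)
(* Take a random walk of length n(T+1) from a random vertex, resampling the n
   coordinates cyclically, and let f decrease along the walk and equal the
   distance to the start elsewhere: the end of the walk is the only local
   minimum.  Positions at least n steps apart are independent and uniform, so
   the first t queries, unless one of them hits the walk by luck, only reveal
   its first n*t steps.  Each of the T+1 choices hits one of the n(T+1)
   positions with probability at most n(T+1)/2^n, so for T of order 2^(n/2)/n a
   deterministic algorithm succeeds within T queries with probability at most
   1/2; averaging over the coins and Markov's inequality conclude. *)

Require Import Defs.
From mathcomp Require Import all_boot all_order all_algebra.
From mathcomp Require Import all_classical all_reals all_analysis.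
From mathcomp Require Import measurable_realfun zify lra.

Set Implicit Arguments.
Unset Strict Implicit.
Unset Printing Implicit Defensive.

Import Order.TTheory GRing.Theory Num.Theory.
Import numFieldNormedType.Exports.

Local Open Scope classical_set_scope.
Local Open Scope ring_scope.

(** * Hypercube distance and the random walk *)

Definition hamming (n : nat) (x y : n.-tuple bool) : nat :=
  #|[set i : 'I_n | tnth x i != tnth y i]%SET|.

Lemma hamming_decrease (n : nat) (x y : n.-tuple bool) :
  x != y -> exists2 u, hypercube x u & (hamming u y < hamming x y)%N.
Proof.
move=> xy.
have [i xyi] : exists i, tnth x i != tnth y i.
  apply/existsP; apply: contraNT xy; rewrite negb_exists => /forallP e.
  by apply/eqP/eq_from_tnth => i; apply/eqP; have := e i; rewrite negbK.
pose u := [tuple if j == i then tnth y j else tnth x j | j < n].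
have uE j : tnth u j = if j == i then tnth y j else tnth x j.
  by rewrite tnth_mktuple.
exists u.
  apply/cards1P; exists i; apply/setP => j; rewrite !inE uE.
  by case: (eqVneq j i) => [->|]; rewrite ?eqxx.
apply: proper_card; apply/properP; split.
  by apply/fintype.subsetP => j; rewrite !inE uE; case: ifP; rewrite ?eqxx.
by exists i; rewrite !inE // uE !eqxx.
Qed.

(* Position [p] of the walk keeps, for each coordinate [i], the unique bit [b j]
   with [p <= j < p + n] and [j = i mod n]; moving to [p + 1] resamples
   coordinate [p mod n], so every [n] steps the vertex is completely renewed. *)
Definition walk (n : nat) (b : nat -> bool) (p : nat) : n.-tuple bool :=
  [tuple b (p + (i + (n - p %% n)) %% n)%N | i < n].

Lemma tnth_walk (n : nat) (b : nat -> bool) (p j : nat) (i : 'I_n) :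
  (p <= j < p + n)%N -> (j %% n)%N = i -> tnth (walk n b p) i = b j.
Proof.
move=> /andP[pj jpn] ji; rewrite tnth_mktuple -ji modnDml; congr b.
have n0 : (0 < n)%N by case: (n) i {jpn ji} => [[]|].
have -> : (j + (n - p %% n) = (p %/ n).+1 * n + (j - p))%N.
  by have := divn_eq p n; have := ltn_pmod p n0; rewrite mulSn; lia.
by rewrite modnMDl modn_small; lia.
Qed.

Lemma walk_index_mod (n p : nat) (i : 'I_n) :
  ((p + (i + (n - p %% n)) %% n) %% n)%N = i.
Proof.
have n0 : (0 < n)%N by case: (n) i => [[]|].
rewrite modnDmr.
have -> : (p + (i + (n - p %% n)) = (p %/ n).+1 * n + i)%N.
  by have := divn_eq p n; have := ltn_pmod p n0; rewrite mulSn; lia.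
by rewrite modnMDl modn_small.
Qed.

Definition agree (q : nat) (b b' : nat -> bool) : Prop :=
  forall j, (j < q)%N -> b j = b' j.

Lemma agreeW (q q' : nat) (b b' : nat -> bool) :
  (q <= q')%N -> agree q' b b' -> agree q b b'.
Proof. by move=> qq' bb' j jq; apply: bb'; apply: leq_trans qq'. Qed.

Lemma walk_agree (n : nat) (b b' : nat -> bool) (p : nat) :
  agree (p + n) b b' -> walk n b p = walk n b' p.
Proof.
move=> bb'; apply: eq_from_tnth => i; rewrite !tnth_mktuple; apply: bb'.
by rewrite ltn_add2l ltn_pmod //; case: (n) i => [[]|].
Qed.

Lemma walk_step (n : nat) (b : nat -> bool) (p : nat) :
  walk n b p != walk n b p.+1 -> hypercube (walk n b p) (walk n b p.+1).
Proof.
move=> neq; rewrite /hypercube eqn_leq; apply/andP; split; last first.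
  rewrite card_gt0; apply: contra neq => /eqP/setP e.
  apply/eqP/eq_from_tnth => i; apply/eqP.
  by have := e i; rewrite !inE => /negbT; rewrite negbK.
apply/card_le1_eqP => i j.
suff diff k : k \in [set k | tnth (walk n b p) k != tnth (walk n b p.+1) k]%SET
    -> val k = (p %% n)%N.
  by move=> /diff vi /diff vj; apply: val_inj; rewrite vi vj.
rewrite inE => kd; apply/eqP; apply: contraNT kd => kp.
have n0 : (0 < n)%N by case: (n) k kp => [[]|].
(* [j'] is the index of the bit that coordinate [k] reads at position [p]; as [k] is not [p %% n],
   it differs from [p] and so lies in the window of [p.+1] too. *)
pose j' := (p + (k + (n - p %% n)) %% n)%N.
have lt_n : ((k + (n - p %% n)) %% n < n)%N by rewrite ltn_pmod.
have j'k : (j' %% n = k)%N := walk_index_mod p k.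
have pj' : j' != p by apply: contra kp => /eqP <-; rewrite j'k.
rewrite (@tnth_walk n b p j') ?(@tnth_walk n b p.+1 j') //.
- by move: pj'; rewrite /j'; lia.
- by rewrite /j'; lia.
Qed.

(** * The staircase function and its only possible local minimum *)

(* Only the last visit to a vertex counts, so self-intersections of the walk
   create no spurious local minimum. *)
Fixpoint staircase (R : realType) (n : nat) (b : nat -> bool) (P : nat)
    (v : n.-tuple bool) : R :=
  if P is P'.+1 then
    if v == walk n b P then - P%:R else staircase R b P' v
  else (hamming v (walk n b 0))%:R.

Arguments staircase : clear implicits.

Section Staircase.
Variables (R : realType) (n : nat) (b : nat -> bool).
Implicit Types (P p : nat) (v : n.-tuple bool).

Lemma staircase_ge P v : - P%:R <= staircase R n b P v.
Proof.
elim: P => [|P IH] /=; first by rewrite oppr0.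
by case: ifP => // _; apply: le_trans IH; rewrite lerN2 ler_nat.
Qed.

Lemma staircaseS_le P v : staircase R n b P.+1 v <= staircase R n b P v.
Proof.
rewrite /=; case: ifP => // _; apply: le_trans (staircase_ge P v).
by rewrite lerN2 ler_nat.
Qed.

Lemma staircase_agree b' P v :
  agree (P + n) b b' -> staircase R n b P v = staircase R n b' P v.
Proof.
elim: P => [|P IH] bb' /=; first by rewrite (walk_agree bb').
by rewrite (walk_agree bb') IH //; apply: agreeW bb'; rewrite addSn.
Qed.

(** Each later step changes the function only at the vertex it lands on. Hence a query that misses
    the later positions reveals nothing about them. *)
Lemma staircase_truncate P P' v :
  (P <= P')%N -> (forall p, (P <= p < P')%N -> v != walk n b p.+1) ->
  staircase R n b P' v = staircase R n b P v.
Proof.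
elim: P' => [|P' IH]; first by rewrite leqn0 => /eqP->.
rewrite leq_eqVlt => /predU1P[->//|PP'] nv /=.
rewrite ifN ?nv ?leqnn ?andbT // IH // => p /andP[Pp pP'].
by apply: nv; rewrite Pp ltnS ltnW.
Qed.

(** Off the walk, a step towards the start descends; on it, the step following the last visit does.
    In the induction, lengthening the walk can only lower [u] and, unless it ends at [v], leaves [v]
    alone. *)
Lemma staircase_descent P v : v != walk n b P ->
  exists2 u, hypercube v u & staircase R n b P u < staircase R n b P v.
Proof.
elim: P v => [|P IH] v nv.
  by have [u vu lt_uv] := hamming_decrease nv; exists u => //=; rewrite ltr_nat.
have [vP|/IH[u vu lt_uv]] := eqVneq v (walk n b P).
  exists (walk n b P.+1); first by rewrite vP walk_step -?vP.
  rewrite /= eqxx (negbTE nv); apply: lt_le_trans (staircase_ge P v).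
  by rewrite ltrN2 ltr_nat.
exists u => //; apply: le_lt_trans (staircaseS_le P u) _.
by rewrite /= (negbTE nv).
Qed.

Lemma staircase_local_min P v :
  local_min (@hypercube n) (staircase R n b P) v -> v = walk n b P.
Proof.
move=> vmin; apply/eqP; apply: contraT => /staircase_descent[u vu].
by rewrite ltNge vmin.
Qed.

End Staircase.

(** * Counting the bit strings whose walk is hit *)

Definition overwrite (n p : nat) (u : n.-tuple bool) (b : nat -> bool) :
    nat -> bool :=
  fun j => if (p <= j < p + n)%N then nth false u (j %% n) else b j.

Lemma walk_overwrite (n p : nat) (u : n.-tuple bool) (b : nat -> bool) :
  walk n (overwrite p u b) p = u.
Proof.
apply: eq_from_tnth => i; rewrite tnth_mktuple /overwrite.
have n0 : (0 < n)%N by case: (n) i {u} => [[]|].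
rewrite leq_addr ltn_add2l ltn_pmod //= walk_index_mod.
by rewrite (tnth_nth false).
Qed.

Lemma overwrite_walk (n p : nat) (b : nat -> bool) (j : nat) :
  overwrite p (walk n b p) b j = b j.
Proof.
rewrite /overwrite; case: ifP => // jp.
have n0 : (0 < n)%N by lia.
by rewrite -(@tnth_walk n b p j (Ordinal (ltn_pmod j n0))) // (tnth_nth false).
Qed.

(* Overwriting the bits of the window at [p] turns each hit into [2 ^ n]
   different bit strings on which [g] has the same value. *)
Lemma card_hit (m n p : nat) (g : m.-tuple bool -> n.-tuple bool) :
  (p + n <= m)%N ->
  (forall B B' : m.-tuple bool,
     agree p (nth false B) (nth false B') -> g B = g B') ->
  (#|[set B : m.-tuple bool | g B == walk n (nth false B) p]%SET| * 2 ^ n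
     <= 2 ^ m)%N.
Proof.
move=> pnm gP; set S := [set B | _]%SET.
pose put (B : m.-tuple bool) (u : n.-tuple bool) :=
  [tuple overwrite p u (nth false B) j | j < m].
have nth_put B u j : (j < m)%N ->
    nth false (put B u) j = overwrite p u (nth false B) j.
  by move=> jm; rewrite -(tnth_nth false _ (Ordinal jm)) tnth_mktuple.
have walk_put B u : walk n (nth false (put B u)) p = u.
  rewrite -[RHS](walk_overwrite p u (nth false B)); apply: walk_agree => j jp.
  by rewrite nth_put //; apply: leq_trans pnm.
have g_put B u : g (put B u) = g B.
  apply: gP => j jp; rewrite nth_put; last by lia.
  by rewrite /overwrite leqNgt jp.
have put_put B u u' : put (put B u) u' = put B u'.
  apply: eq_from_tnth => j; rewrite !tnth_mktuple /overwrite.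
  by case: ifP => // jp; rewrite nth_put // /overwrite jp.
have put_walk B : put B (walk n (nth false B) p) = B.
  apply: eq_from_tnth => j.
  by rewrite tnth_mktuple overwrite_walk -tnth_nth.
(* From [put B u], one reads off [u] at position [p]. Its value of [g] is that of [B], which for a
   hit encodes the overwritten window; writing it back restores [B]. *)
have inj : {in finset.setX S [set: n.-tuple bool]%SET &,
    injective (uncurry put)}.
  move=> [B u] [B' u']; rewrite !inE !andbT => /eqP gB /eqP gB' /= e.
  have uu' : u = u' by rewrite -(walk_put B u) e walk_put.
  congr (_, _) => //; rewrite -(put_walk B) -(put_walk B') -gB -gB'.
  by rewrite -(put_put B u) -(put_put B' u') -(g_put B u) -(g_put B' u') e.
have := max_card [in (uncurry put) @: finset.setX S [set: n.-tuple bool]%SET].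
by rewrite card_in_imset // cardsX cardsT !card_tuple card_bool.
Qed.

(** * Deterministic algorithms against the random walk *)

(** An output is treated as one more guess: a correct one must also hit the walk. *)
Definition vertex_of (V : Type) (a : action V) : V :=
  match a with Query v => v | Output v => v end.

(* The run in which the [t]-th query is answered as if the walk stopped after
   [n * t] steps, so that it only depends on the first [n * t] bits. *)
Fixpoint truncated_run (R : realType) (n : nat) (s : det_alg R (n.-tuple bool))
    (b : nat -> bool) (t : nat) : history R (n.-tuple bool) :=
  if t is t'.+1 then
    let h := truncated_run s b t' in
    if s h is Query v then rcons h (v, staircase R n b (n * t')%N v) else h
  else [::].

Lemma truncated_run_agree (R : realType) (n : nat)
    (s : det_alg R (n.-tuple bool)) (b b' : nat -> bool) (t : nat) :
  agree (n * t) b b' -> truncated_run s b t = truncated_run s b' t.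
Proof.
elim: t => //= t IH bb'; rewrite -IH; last first.
  by apply: agreeW bb'; rewrite leq_mul2l leqnSn orbT.
case: (s _) => // v; congr (rcons _ (_, _)); apply: staircase_agree.
by rewrite -mulnSr.
Qed.

Section LuckyRuns.
Variables (R : realType) (n : nat) (s : det_alg R (n.-tuple bool)) (T : nat).
(** The last position, [n * T.+1], reads a window of [n] further bits. *)
Let m := (n * T.+2)%N.
Implicit Type B : m.-tuple bool.

Let choice_at B t := vertex_of (s (truncated_run s (nth false B) t)).

Definition lucky : {set m.-tuple bool} :=
  [set B : m.-tuple bool | [exists t : 'I_T.+1, [exists p : 'I_(n * T.+1),
     (n * t <= p)%N && (choice_at B t == walk n (nth false B) p.+1)]]]%SET.

(** Union bound over [T.+1] choices and [n * T.+1] positions. *)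
Lemma card_lucky : (#|lucky| * 2 ^ n <= n * T.+1 ^ 2 * 2 ^ m)%N.
Proof.
pose hit (t : 'I_T.+1) (p : 'I_(n * T.+1)) : {set m.-tuple bool} :=
  [set B : m.-tuple bool | (n * t <= p)%N &&
     (choice_at B t == walk n (nth false B) p.+1)]%SET.
have hit_le t p : (#|hit t p| * 2 ^ n <= 2 ^ m)%N.
  have [tp|ntp] := boolP (n * t <= p)%N; last first.
    rewrite (_ : hit t p = finset.set0) ?cards0 //.
    by apply/setP => B; rewrite !inE (negbTE ntp).
  (* The choice depends only on the first [n * t] bits, all of which precede the window at
     [p.+1]. *)
  rewrite /hit tp /=; apply: (card_hit (g := choice_at^~ t)).
    by rewrite /m [leqRHS]mulnSr leq_add2r.
  move=> B B' BB'; rewrite /choice_at; congr (vertex_of (s _)).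
  by apply: truncated_run_agree; apply: agreeW BB'; apply: leqW.
have sub : lucky \subset (\bigcup_t \bigcup_p hit t p)%SET.
  apply/fintype.subsetP => B; rewrite inE => /existsP[t /existsP[p tp]].
  apply/finset.bigcupP; exists t => //; apply/finset.bigcupP; exists p => //.
  by rewrite inE.
have union_bound (I : finType) (F : I -> {set m.-tuple bool}) c :
    (forall i, #|F i| * 2 ^ n <= c)%N ->
    (#|\bigcup_i F i|%SET * 2 ^ n <= #|I| * c)%N.
  move=> Fc; have -> : (#|I| * c = \sum_(i : I) c)%N by rewrite sum_nat_const.
  apply: (@leq_trans (\sum_i #|F i| * 2 ^ n)%N); last by apply: leq_sum => i _.
  rewrite -big_distrl leq_mul2r; apply/orP; right.
  elim/big_ind2: _ => [|A a A' a' Aa Aa'|//]; first by rewrite cards0.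
  apply: leq_trans (leq_add Aa Aa').
  by rewrite cardsU leq_subr.
apply: (@leq_trans (#|\bigcup_t \bigcup_p hit t p|%SET * 2 ^ n)).
  by rewrite leq_mul2r subset_leq_card ?orbT.
apply: leq_trans (union_bound _ _ (n * T.+1 * 2 ^ m)%N _) _; last first.
  by rewrite card_ord; lia.
by move=> t; have := union_bound _ (hit t) _ (hit_le t); rewrite card_ord.
Qed.

(** By induction the two histories agree, so the next query is the same choice; it misses all
    positions after [n * t], where alone the two answers could differ. *)
Lemma run_unlucky B t : B \notin lucky -> (t <= T)%N ->
  run s (staircase R n (nth false B) (n * T.+1)) t
    = truncated_run s (nth false B) t.
Proof.
rewrite inE negb_exists => /forallP nB; elim: t => //= t IH tT.
rewrite IH ?(ltnW tT) //; case sh: (s _) => [v|v] //.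
congr (rcons _ (_, _)); apply: staircase_truncate.
  by rewrite leq_mul2l (leq_trans (ltnW tT)) ?orbT.
move=> p /andP[tp pM].
have := nB (Ordinal (leqW tT)); rewrite negb_exists.
move=> /forallP/(_ (Ordinal pM)).
by rewrite /= tp /choice_at sh.
Qed.

Lemma success_lucky B v : (0 < n)%N ->
  let f := staircase R n (nth false B) (n * T.+1) in
  s (run s f T) = Output v -> local_min (@hypercube n) f v -> B \in lucky.
Proof.
move=> n0 f sv /staircase_local_min vM; apply: contraT => nB.
move: sv; rewrite (run_unlucky nB) // => sv.
case/negP: nB; rewrite inE; apply/existsP.
exists ord_max; apply/existsP.
(* In [lucky] the index [p] stands for position [p.+1], so the end of the walk has index
   [(n * T.+1).-1]. *)
have Mlt : ((n * T.+1).-1 < n * T.+1)%N by rewrite prednK ?muln_gt0 ?n0.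
exists (Ordinal Mlt) => /=; rewrite /choice_at sv /= prednK ?muln_gt0 ?n0 //.
by rewrite -vM eqxx andbT -ltnS prednK ?muln_gt0 ?n0 // ltn_mul2l n0 ltnSn.
Qed.

End LuckyRuns.

(** * Query counts and measurability *)

Lemma run_halted (R V : Type) (s : det_alg R V) (f : V -> R) (v : V)
    (j k : nat) :
  (j <= k)%N -> s (run s f j) = Output v -> run s f k = run s f j.
Proof.
move=> /subnK <- sv; elim: (k - j)%N => //= i IH.
by rewrite IH sv.
Qed.

Definition is_query (V : Type) (a : action V) : bool :=
  if a is Query _ then true else false.

(** Halting is permanent, so an algorithm that queries at step [T] has queried at each of the steps
    0 to [T]. *)
Lemma num_queries_ge (R : realType) (V : Type) (s : det_alg R V) (f : V -> R)
    (T : nat) :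
  is_query (s (run s f T)) -> (T.+1%:R%:E <= num_queries s f)%E.
Proof.
move=> qT.
pose q k : \bar R := if s (run s f k) is Query _ then 1%E else 0%E.
have q0 k : (0 <= q k)%E by rewrite /q; case: (s _).
apply: le_trans (@nneseries_lim_ge R q xpredT 0 T.+1 (fun k _ _ => q0 k)).
rewrite big_nat (eq_bigr (fun=> 1%E)); last first.
  move=> k /andP[_ kT]; rewrite /q; case sk: (s _) => [//|v].
  by move: qT; rewrite (run_halted _ sk) ?sk.
by rewrite -big_nat sumEFin lee_fin sumr_const_nat subn0.
Qed.

Section Measurability.
Variables (R : realType) (V : finType) (A : rand_alg R V) (f : V -> R).

(** Against a fixed [f], a history is determined by the vertices queried. Only countably many pairs
    of history and action can occur, so the event is a countable union of measurable ones. *)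
Lemma measurable_run_decide_of k :
  (forall h, measurable [set w | run (decide A w) f k = h]) ->
  forall Phi : history R V -> action V -> Prop,
  measurable [set w | Phi (run (decide A w) f k)
                          (decide A w (run (decide A w) f k))].
Proof.
move=> mrun Phi.
pose h_of (vs : seq V) : history R V := [seq (v, f v) | v <- vs].
pose a_of (x : V + V) := match x with inl v => Query v | inr v => Output v end.
pose F (x : seq V * (V + V)) : set (coins A) :=
  [set w | run (decide A w) f k = h_of x.1] `&`
  [set w | decide A w (h_of x.1) = a_of x.2] `&`
  [set w | Phi (h_of x.1) (a_of x.2)].
rewrite (_ : [set w | _] = \bigcup_x F x); last first.
  apply/seteqP; split=> w /=; last by case=> -[vs x] _ [[/= -> ->]].
  move=> Phiw.
  have [vs runE] : exists vs, run (decide A w) f k = h_of vs.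
    elim: (k) => [|j [vs IH]] /=; first by exists [::].
    rewrite IH; case: (decide A w _) => [v|_]; last by exists vs.
    by exists (rcons vs v); rewrite /h_of map_rcons.
  have [x aE] : exists x, decide A w (h_of vs) = a_of x.
    by case: (decide A w _) => v; [exists (inl v)|exists (inr v)].
  by exists (vs, x) => //; split; [split|rewrite /= -aE -runE].
apply: countable_bigcupT_measurable => [|x]; first exact: countableP.
apply: measurableI.
  by apply: measurableI; [exact: mrun|exact: measurable_decide].
have [Phix|nPhix] := pselect (Phi (h_of x.1) (a_of x.2)).
  by rewrite (_ : [set w | _] = setT) //; apply/seteqP; split.
by rewrite (_ : [set w | _] = set0) //; apply/seteqP; split.
Qed.

Lemma measurable_run_decide k (Phi : history R V -> action V -> Prop) :
  measurable [set w | Phi (run (decide A w) f k)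
                          (decide A w (run (decide A w) f k))].
Proof.
apply: measurable_run_decide_of => {Phi}; elim: k => [|k IH] h /=.
  have [->|nh] := pselect (h = [::]).
    by rewrite (_ : [set w | _] = setT) //; apply/seteqP; split.
  by rewrite (_ : [set w | _] = set0) //; apply/seteqP; split=> // w /esym.
exact: (measurable_run_decide_of IH (fun h' a =>
  (if a is Query v then rcons h' (v, f v) else h') = h)).
Qed.

Lemma measurable_num_queries :
  measurable_fun setT
    ((fun w => num_queries (decide A w) f) : coins A -> \bar R).
Proof.
rewrite /num_queries.
apply: (@ge0_emeasurable_sum _ _ _ setT (fun k w =>
  if decide A w (run (decide A w) f k) is Query _ then 1%E else 0%E) xpredT).
  by move=> k w _ _; case: (decide A w _).
move=> k _.
rewrite (_ : (fun w => _) = (fun w =>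
    (\1_[set w | is_query (decide A w (run (decide A w) f k))] w)%:E)).
  apply/measurable_EFinP/measurable_indic.
  exact: (measurable_run_decide k (fun _ a => is_query a)).
apply/funext => w; rewrite indicE; case aE: (decide A w _) => [v|v].
  by rewrite mem_set //= aE.
by rewrite memNset //= aE.
Qed.

(** Markov's inequality for the event of still querying at step [T]. *)
Lemma expected_queries_ge T :
  (T.+1%:R%:E *
     coins_law A [set w | is_query (decide A w (run (decide A w) f T))]
   <= expected_queries A f)%E.
Proof.
set Q := [set w | _].
have mQ : measurable Q.
  exact: (measurable_run_decide T (fun _ a => is_query a)).
rewrite -[Q]setIT -(integral_indic _ _ mQ) // -ge0_integralZl //=; last first.
  exact/measurable_EFinP/measurable_indic.
apply: ge0_le_integral => //=.
- by apply: measurable_funeM; apply/measurable_EFinP/measurable_indic.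
- exact: measurable_num_queries.
move=> w _; rewrite indicE; have [wQ|wQ] := boolP (w \in Q).
  by rewrite mule1; apply: num_queries_ge; move: wQ; rewrite inE.
by rewrite mule0; apply: nneseries_ge0 => k _ _; case: (decide A w _).
Qed.

Definition success_by (e : rel V) (T : nat) : set (coins A) :=
  [set w | exists2 v, decide A w (run (decide A w) f T) = Output v &
                      local_min e f v].

Lemma measurable_success_by e T : measurable (success_by e T).
Proof.
exact: (measurable_run_decide T
  (fun _ a => exists2 v, a = Output v & local_min e f v)).
Qed.

(** A run that eventually succeeds either has its final output by step [T] or is still querying
    then. *)
Lemma success_probability_le e T :
  (success_probability e A f <= coins_law A (success_by e T) +
     coins_law A [set w | is_query (decide A w (run (decide A w) f T))])%E.
Proof.
set Q := [set w | _].
have mQ : measurable Q.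
  exact: (measurable_run_decide T (fun _ a => is_query a)).
have mS := measurable_success_by e.
apply: le_trans (measureU2 _ (mS T) mQ).
apply: le_measure; rewrite ?inE; [|exact: measurableU|].
  rewrite (_ : [set w | _] = \bigcup_k success_by e k).
    exact: bigcupT_measurable.
  apply/seteqP; split=> w /=.
    by case=> v [[k sv] vmin]; exists k => //; exists v.
  by case=> k _ [v sv vmin]; exists v; split => //; exists k.
move=> w [v [[k sv] vmin]].
have [wQ|] := boolP (is_query (decide A w (run (decide A w) f T))).
  by right.
case aE: (decide A w _) => [//|u] _; left; exists v => //.
have [kT|/ltnW Tk] := leqP k T; first by rewrite (run_halted kT sv).
by move: sv; rewrite (run_halted Tk aE).
Qed.

End Measurability.

(** * Averaging over coins and inputs *)

(* Yao's principle for the uniform distribution on a finite family of inputs. *)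
Lemma worst_case_queries_ge (R : realType) (V I : finType) (e : rel V)
    (A : rand_alg R V) (F : I -> V -> R) (T : nat) (delta : R) :
  solves_local_search e A -> (0 < #|I|)%N ->
  (forall s : det_alg R V,
     (#|[set i | `[< exists2 v, s (run s (F i) T) = Output v &
                                local_min e (F i) v >]]%SET|%:R
       <= delta * #|I|%:R)) ->
  ((T.+1%:R * (9 / 10 - delta))%:E <= worst_case_queries A)%E.
Proof.
move=> solA I0 succ_le.
pose S i : set (coins A) := success_by (F i) e T.
have mS i : measurable (S i) := measurable_success_by A (F i) e T.
pose Q i := [set w | is_query (decide A w (run (decide A w) (F i) T))].
have mQ i : measurable (Q i).
  exact: (measurable_run_decide A (F i) T (fun _ a => is_query a)).
(* With sum and integral exchanged, the integrand counts the inputs solved by a single deterministic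
   algorithm, to which [succ_le] applies. *)
have sumS : (\sum_(i : I) coins_law A (S i) <= (delta * #|I|%:R)%:E)%E.
  under eq_bigr do rewrite -[S _]setIT -integral_indic //.
  rewrite -ge0_integral_sum //=; last first.
    by move=> i; apply/measurable_EFinP/measurable_indic.
  apply: (@le_trans _ _ (\int[coins_law A]_w (delta * #|I|%:R)%:E)%E).
    apply: ge0_le_integral => //=.
    - by move=> w _; apply: sume_ge0 => i _; rewrite lee_fin.
    - by apply: emeasurable_sum => i; apply/measurable_EFinP/measurable_indic.
    move=> w _; rewrite sumEFin lee_fin; apply: le_trans (succ_le (decide A w)).
    rewrite -sum1_card natr_sum [leRHS]big_mkcond /=; apply: ler_sum => i _.
    rewrite inE indicE; have [|_] := boolP (w \in S i); last by case: ifP.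
    by rewrite inE => /asboolT->.
  rewrite integral_cst // [X in (_ * X <= _)%E](_ : _ = 1%E) ?mule1 //.
  exact: probability_setT.
have cost i : (T.+1%:R%:E * coins_law A (Q i) <= worst_case_queries A)%E.
  apply: le_trans (expected_queries_ge A (F i) T) _.
  by apply: ereal_sup_ubound; exists (F i).
(* The value [+oo] is trivial, and [-oo] is excluded by a nonnegative cost, one existing since [I]
   is nonempty. *)
case: (worst_case_queries A) cost => [x| |] cost; last 2 first.
- by rewrite leey.
- have [i _] := card_gt0P I0; have := cost i; rewrite leNgt => /negP[].
  by apply: (@lt_le_trans _ _ 0%E); rewrite ?ltNy0 // mule_ge0 // lee_fin.
have fS i : (fine (coins_law A (S i)))%:E = coins_law A (S i).
  by rewrite fineK ?fin_num_measure.
have fQ i : (fine (coins_law A (Q i)))%:E = coins_law A (Q i).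
  by rewrite fineK ?fin_num_measure.
have costR : T.+1%:R * (\sum_i fine (coins_law A (Q i))) <= x * #|I|%:R.
  rewrite mulr_sumr mulr_natr -sumr_const; apply: ler_sum => i _.
  by have := cost i; rewrite -fQ lee_fin.
have succR : 9 / 10 * #|I|%:R <=
    \sum_i fine (coins_law A (S i)) + \sum_i fine (coins_law A (Q i)).
  rewrite -big_split /= mulr_natr -sumr_const; apply: ler_sum => i _.
  have := le_trans (solA (F i)) (success_probability_le A (F i) e T).
  by rewrite -/(S i) -/(Q i) -fS -fQ lee_fin.
have sumSR : \sum_i fine (coins_law A (S i)) <= delta * #|I|%:R.
  by rewrite -lee_fin -sumEFin; under eq_bigr do rewrite fS.
have I0R : 0 < #|I|%:R :> R by rewrite ltr0n.
rewrite lee_fin -(ler_pM2r I0R); apply: le_trans costR.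
by rewrite -mulrA ler_wpM2l //; lra.
Qed.

(** * The bound on the hypercube and the choice of parameters *)

(** The lucky bit strings have density at most [n * T.+1 ^ 2 / 2 ^ n], which the second hypothesis
    makes at most 1/2. *)
Lemma hypercube_worst_case_queries (R : realType) (n T : nat)
    (A : rand_alg R (n.-tuple bool)) :
  (0 < n)%N -> (2 * (n * T.+1 ^ 2) <= 2 ^ n)%N ->
  solves_local_search (@hypercube n) A ->
  ((T.+1%:R * (9 / 10 - 1 / 2))%:E <= worst_case_queries A)%E.
Proof.
move=> n0 nT solA; set m := (n * T.+2)%N.
pose F (B : m.-tuple bool) := staircase R n (nth false B) (n * T.+1).
apply: (worst_case_queries_ge (F := F) solA) => [|s].
  by rewrite card_tuple card_bool expn_gt0.
set S := [set B | _]%SET.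
have subS : (#|S| <= #|lucky s T|)%N.
  apply/subset_leq_card/fintype.subsetP => B.
  rewrite inE => /asboolP[v sv vmin].
  exact: success_lucky sv vmin.
have : (#|S| * 2 <= 2 ^ m)%N.
  rewrite -(@leq_pmul2r (2 ^ n)) ?expn_gt0 //.
  apply: (@leq_trans (#|lucky s T| * 2 ^ n * 2)).
    by rewrite mulnAC leq_mul2r leq_mul2r subS !orbT.
  apply: (@leq_trans (n * T.+1 ^ 2 * 2 ^ m * 2)).
    by rewrite leq_mul2r card_lucky orbT.
  by rewrite mulnAC [leqRHS]mulnC leq_mul2r [(_ * 2)%N]mulnC nT orbT.
rewrite card_tuple card_bool -(ler_nat R) natrM; lra.
Qed.

(** Ensures that 2^(n/2) / n is at least 1, so that its integer part is positive. *)
Lemma sqr_le_exp2 (n : nat) : (4 <= n)%N -> (n ^ 2 <= 2 ^ n)%N.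
Proof.
elim: n => // n IH; rewrite leq_eqVlt => /predU1P[<-//|n4].
have := IH n4; rewrite !expnS expn0; nia.
Qed.

Theorem corollary4 (R : realType) :
  exists c : R, 0 < c /\
    \forall n \near \oo,
      ((c * (2 `^ (n%:R / 2) / n%:R))%:E
         <= randomized_query_complexity R (@hypercube n))%E.
Proof.
(* With [D] the integer part of [y], the bound obtained is 2/5 of [D], and [y < D + 1 <= 2 * D]. *)
exists (1 / 5); split; first lra.
near=> n.
have n4 : (4 <= n)%N by near: n; exact: nbhs_infty_ge.
have n0 : 0 < n%:R :> R by rewrite ltr0n (leq_trans _ n4).
set r : R := 2 `^ (n%:R / 2); set y := r / n%:R.
have r2 : r ^+ 2 = (2 ^ n)%:R.
  by rewrite -powR_mulrn ?powR_ge0 // -powRrM divfK // powR_mulrn // natrX.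
have r0 : 0 <= r by exact: powR_ge0.
have y1 : 1 <= y.
  rewrite ler_pdivlMr // mul1r -(@ler_pXn2r _ 2) ?nnegrE ?(ltW n0) //.
  by rewrite r2 -natrX ler_nat sqr_le_exp2.
have /andP[yl yu] := truncn_itv (le_trans ler01 y1).
set D := Num.truncn y in yl yu.
have D0 : (0 < D)%N by rewrite truncn_gt0.
(* Squaring [n * D <= r] bounds [n ^ 2 * D ^ 2] by [2 ^ n], and [2 * n <= n ^ 2]. *)
have nD : (2 * (n * D ^ 2) <= 2 ^ n)%N.
  have : (n ^ 2 * D ^ 2 <= 2 ^ n)%N.
    rewrite -(ler_nat R) -r2 natrM !natrX -exprMn ler_pXn2r ?nnegrE //.
    by rewrite mulrC -ler_pdivlMr.
  by apply: leq_trans; rewrite mulnA leq_mul2r !expnS expn0; nia.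
apply: le_ereal_inf_tmp => _ [A [solA <-]].
have := @hypercube_worst_case_queries R n D.-1 A.
rewrite prednK // => /(_ (leq_trans _ n4) nD solA) lb.
apply: le_trans (lb isT); rewrite lee_fin.
have D1 : 1 <= D%:R :> R by rewrite ler1n.
move: yu; rewrite -natr1; lra.
Unshelve. all: by end_near.
Qed.
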